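(* Let $p$ be a prime and let $E/\mathbb{Q}$ be an elliptic curve. In each of the following cases, as $P$ varies over all nonzero points of $E[p]$, the set of values attained by $[\mathbb{Q}(P):\mathbb{Q}]$ is exactly the set listed (equality ''$G_E(p)=G$'' meaning that this holds for a suitable choice of basis of $E[p]$, i.e. that $G_E(p)$ is conjugate to $G$ in $\operatorname{GL}_2(\mathbb{F}_p)$; in all cases other than the first, $p$ is odd). \begin{itemize} \item If $G_E(p)=\operatorname{GL}_2(\mathbb{F}_p)$: $\{p^2-1\}$. \item If $G_E(p)=C_{ns}^+(p)$: $\{p^2-1\}$. \item If $G_E(p)=C_s^+(p)$: $\{2(p-1),\ (p-1)^2\}$. \item If $p\in\{3,7,11,19,43,67,163\}$ and $G_E(p)=G_{00}(p)$: $\{p-1,\ (p-1)p\}$. \item If $p\in\{3,7,11,19,43,67,163\}$ and $G_E(p)=G_{01}(p)$: $\{p-1,\ (p-1)p/2\}$. \item If $p\in\{3,7,11,19,43,67,163\}$ and $G_E(p)=G_{10}(p)$: $\{(p-1)/2,\ (p-1)p\}$. \item If $p\equiv 1\pmod 3$ and $G_E(p)=G^3(p)$: $\{2(p-1),\ (p-1)^2/3,\ 2(p-1)^2/3\}$. \item If $p\equiv 2\pmod 3$ and $G_E(p)=G_0(p)$: $\{(p^2-1)/3,\ 2(p^2-1)/3\}$. \end{itemize}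
   Context: For an elliptic curve $E/\mathbb{Q}$ and a prime $p$, $E[p]\subset E(\overline{\mathbb{Q}})$ is the $p$-torsion subgroup; choosing a basis of $E[p]$ over $\mathbb{F}_p$, the action of $\operatorname{Gal}(\overline{\mathbb{Q}}/\mathbb{Q})$ on $E[p]$ gives a homomorphism $\rho_{E,p}:\operatorname{Gal}(\overline{\mathbb{Q}}/\mathbb{Q})\to\operatorname{GL}_2(\mathbb{F}_p)$ (matrices acting on column vectors of coordinates), and $G_E(p)$ denotes its image, well defined up to conjugacy. For $P\in E(\overline{\mathbb{Q}})$, $\mathbb{Q}(P)$ is the field generated by the coordinates of $P$. For $p$ odd, let $\epsilon=-1$ if $p\equiv 3\pmod 4$, and otherwise let $\epsilon\ge 2$ be the smallest integer with $\left(\frac{\epsilon}{p}\right)=-1$. Put $$D(a,b)=\begin{pmatrix}a&0\\0&b\end{pmatrix},\quad M_\epsilon(a,b)=\begin{pmatrix}a&b\epsilon\\ b&a\end{pmatrix},\quad T=\begin{pmatrix}0&1\\1&0\end{pmatrix},\quad J=\begin{pmatrix}1&0\\0&-1\end{pmatrix}.$$ The following are subgroups of $\operatorname{GL}_2(\mathbb{F}_p)$: \begin{itemize} \item $C_s^+(p)=\{D(a,b),\ T\cdot D(a,b): a,b\in\mathbb{F}_p^\times\}$; \item $C_{ns}^+(p)=\{M_\epsilon(a,b),\ J\cdot M_\epsilon(a,b):(a,b)\in\mathbb{F}_p^2,\ (a,b)\neq(0,0)\}$; \item $G_{00}(p)=\left\{\begin{pmatrix}a&b\\0&\pm a\end{pmatrix}:a\in\mathbb{F}_p^\times,\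 b\in\mathbb{F}_p\right\}$; \item $G_{10}(p)=\left\{\begin{pmatrix}a&b\\0&\pm a\end{pmatrix}:a\in(\mathbb{F}_p^\times)^2,\ b\in\mathbb{F}_p\right\}$; \item $G_{01}(p)=\left\{\begin{pmatrix}\pm a&b\\0&a\end{pmatrix}:a\in(\mathbb{F}_p^\times)^2,\ b\in\mathbb{F}_p\right\}$; \item $G^3(p)=\{D(a,ab^3),\ T\cdot D(a,ab^3):a,b\in\mathbb{F}_p^\times\}$; \item $G_0(p)=\{M_\epsilon(a,b)^3,\ J\cdot M_\epsilon(a,b)^3:(a,b)\in\mathbb{F}_p^2,\ (a,b)\neq(0,0)\}$ (for $p\equiv 2\pmod 3$). \end{itemize} *)

(* Defs.v *)
From HB Require Import structures.
From mathcomp Require Import all_boot all_order all_fingroup all_algebra.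
From mathcomp Require Import all_field.

Set Implicit Arguments.
Unset Strict Implicit.
Unset Printing Implicit Defensive.

Import GRing.Theory.
Local Open Scope ring_scope.

(* y^2 + a1 x y + a3 y = x^3 + a2 x^2 + a4 x + a6 *)
Record weierstrass (F : Type) :=
  Weierstrass { wa1 : F; wa2 : F; wa3 : F; wa4 : F; wa6 : F }.

Definition map_weierstrass (F K : Type) (f : F -> K) (W : weierstrass F) :=
  Weierstrass (f (wa1 W)) (f (wa2 W)) (f (wa3 W)) (f (wa4 W)) (f (wa6 W)).

Definition discriminant (F : fieldType) (W : weierstrass F) : F :=
  let: Weierstrass a1 a2 a3 a4 a6 := W in
  let b2 := a1 ^+ 2 + 4%:R * a2 in
  let b4 := 2%:R * a4 + a1 * a3 in
  let b6 := a3 ^+ 2 + 4%:R * a6 in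
  let b8 := a1 ^+ 2 * a6 + 4%:R * a2 * a6 - a1 * a3 * a4 + a2 * a3 ^+ 2
            - a4 ^+ 2 in
  - b2 ^+ 2 * b8 - 8%:R * b4 ^+ 3 - 27%:R * b6 ^+ 2 + 9%:R * b2 * b4 * b6.

Record elliptic_curve (F : fieldType) := EllipticCurve {
  weq :> weierstrass F;
  discriminant_neq0 : discriminant weq != 0
}.

(* Points of the projective plane that may lie on a Weierstrass cubic: the
   point at infinity O, the zero of the group law, or an affine point. *)
Inductive point (F : Type) := Inf | Aff of F & F.
Arguments Inf {F}.

Definition map_point (F K : Type) (f : F -> K) (P : point F) : point K :=
  if P is Aff x y then Aff (f x) (f y) else Inf.

Definition coordinates (F : Type) (P : point F) : seq F :=
  if P is Aff x y then [:: x; y] else [::].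

Section GroupLaw.

Variables (F : fieldType) (W : weierstrass F).

Definition on_curve (P : point F) : Prop :=
  if P is Aff x y then
    y ^+ 2 + wa1 W * x * y + wa3 W * y
      = x ^+ 3 + wa2 W * x ^+ 2 + wa4 W * x + wa6 W
  else True.

(* Third intersection point of the cubic with the line of slope l through
   (x1, y1) (the other abscissa being x2), followed by the inversion
   (x, y) |-> (x, - y - a1 x - a3). *)
Definition chord (l x1 y1 x2 : F) : point F :=
  let x3 := l ^+ 2 + wa1 W * l - wa2 W - x1 - x2 in
  Aff x3 (- (l * (x3 - x1) + y1) - wa1 W * x3 - wa3 W).

(* Chord and tangent law, meaningful for points on the curve. *)
Definition padd (P Q : point F) : point F :=
  match P, Q with
  | Inf, _ => Q
  | _, Inf => P
  | Aff x1 y1, Aff x2 y2 =>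
    if x1 != x2 then chord ((y2 - y1) / (x2 - x1)) x1 y1 x2
    else if y1 + y2 + wa1 W * x2 + wa3 W == 0 then Inf
    else chord ((3%:R * x1 ^+ 2 + 2%:R * wa2 W * x1 + wa4 W - wa1 W * y1)
                / (2%:R * y1 + wa1 W * x1 + wa3 W)) x1 y1 x2
  end.

Definition pmul (n : nat) (P : point F) : point F := iter n (padd P) Inf.

End GroupLaw.

Section Torsion.

(* The algebraic closure of the rationals is algC. *)
Variables (E : elliptic_curve rat) (p : nat).

Let EC : weierstrass algC := map_weierstrass ratr E.

Definition torsion (P : point algC) : Prop :=
  on_curve EC P /\ pmul EC p P = Inf.

Definition comb (P1 P2 : point algC) (v : 'cV['F_p]_2) : point algC :=
  padd EC (pmul EC (v 0 0) P1) (pmul EC (v 1 0) P2).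

(* (P1, P2) is an F_p-basis of E[p]: v |-> v0 P1 + v1 P2 is an isomorphism
   of groups (equivalently, of F_p-vector spaces) from F_p^2 onto E[p]. *)
Definition torsion_basis (P1 P2 : point algC) : Prop :=
  [/\ {morph comb P1 P2 : u v / u + v >-> padd EC u v},
      injective (comb P1 P2) &
      forall P, torsion P <-> exists v, P = comb P1 P2 v].

(* Elements of Gal(algC / Q) are the bijective ring morphisms of algC: they
   all fix Q. The columns of the matrix of s are the coordinates of the
   images of the basis. *)
Definition galois_matrix (P1 P2 : point algC) (s : {rmorphism algC -> algC})
    (g : 'M['F_p]_2) : Prop :=
  map_point s P1 = comb P1 P2 (col 0 g) /\
  map_point s P2 = comb P1 P2 (col 1 g).

Definition in_galois_image (P1 P2 : point algC) (g : 'M['F_p]_2) : Prop :=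
  exists s : {rmorphism algC -> algC},
    bijective s /\ galois_matrix P1 P2 s g.

Definition galois_image_is (G : {set 'M['F_p]_2}) : Prop :=
  exists P1 P2, torsion_basis P1 P2 /\
    forall g, in_galois_image P1 P2 g <-> g \in G.

End Torsion.

(* The subfield Q(s) of algC generated by s, as an abstract number field;
   the specification of num_field_exists provides its embedding in algC. *)
Definition adjoin_algC (s : seq algC) : fieldExtType rat :=
  tag (num_field_exists s).

Definition point_degree (P : point algC) : nat :=
  \dim {: adjoin_algC (coordinates P)}.

Definition torsion_degrees_are (E : elliptic_curve rat) (p : nat)
    (ds : seq nat) : Prop :=
  forall d : nat,
    (exists P, [/\ torsion E p P, P <> Inf & point_degree P = d])
      <-> d \in ds.

Section Subgroups.

Variable p : nat.
Implicit Types a b c d : 'F_p.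

Definition mx22 a b c d : 'M['F_p]_2 :=
  \matrix_(i, j) (if i == 0 then if j == 0 then a else b
                  else if j == 0 then c else d).

Definition legendre_m1 (n : nat) : bool :=
  ~~ [exists x : 'F_p, x ^+ 2 == n%:R].

(* The least n >= 2 which is not a square modulo p is at most p - 1 when
   p = 1 modulo 4; the default value of head is then irrelevant. *)
Definition eps : 'F_p :=
  if (p %% 4 == 3)%N then -1
  else (head 0%N [seq n <- iota 2 p | legendre_m1 n])%:R.

Definition Dmx a b := mx22 a 0 0 b.
Definition Mmx a b := mx22 a (b * eps) b a.
Definition Tmx := mx22 0 1 1 0.
Definition Jmx := mx22 1 0 0 (-1).

Definition GL2 : {set 'M['F_p]_2} := [set g | g \in unitmx].

Definition Csp : {set 'M['F_p]_2} :=
  [set g | [exists a, exists b, [&& a != 0, b != 0 &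
     (g == Dmx a b) || (g == Tmx *m Dmx a b)]]].

Definition Cnsp : {set 'M['F_p]_2} :=
  [set g | [exists a, exists b, ((a, b) != (0, 0)) &&
     ((g == Mmx a b) || (g == Jmx *m Mmx a b))]].

Definition G00 : {set 'M['F_p]_2} :=
  [set g | [exists a, exists b, (a != 0) &&
     ((g == mx22 a b 0 a) || (g == mx22 a b 0 (- a)))]].

(* In G10 and G01, c ^+ 2 with c != 0 is a generic nonzero square. *)
Definition G10 : {set 'M['F_p]_2} :=
  [set g | [exists c, exists b, (c != 0) &&
     ((g == mx22 (c ^+ 2) b 0 (c ^+ 2))
      || (g == mx22 (c ^+ 2) b 0 (- c ^+ 2)))]].

Definition G01 : {set 'M['F_p]_2} :=
  [set g | [exists c, exists b, (c != 0) &&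
     ((g == mx22 (c ^+ 2) b 0 (c ^+ 2))
      || (g == mx22 (- c ^+ 2) b 0 (c ^+ 2)))]].

Definition G3 : {set 'M['F_p]_2} :=
  [set g | [exists a, exists b, [&& a != 0, b != 0 &
     (g == Dmx a (a * b ^+ 3)) || (g == Tmx *m Dmx a (a * b ^+ 3))]]].

Definition G0 : {set 'M['F_p]_2} :=
  [set g | [exists a, exists b, ((a, b) != (0, 0)) &&
     ((g == Mmx a b ^+ 3) || (g == Jmx *m Mmx a b ^+ 3))]].

End Subgroups.

(* Main.v *)
(* A point P of E[p] with coordinate vector v is moved by the absolute Galois
   group through the vectors g v, g in G_E(p).  The degree of Q(P) is the number
   of conjugates of a primitive element, hence the number of conjugates of P,
   hence the size of the orbit of v under G_E(p).  The orbits in F_p^2 are then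
   counted group by group.  For G^3(p) the orbit of (x, y), xy <> 0, depends
   only on the cubic residue class of y / x up to inversion.  For the nonsplit
   groups, F_p^2 is the field with p^2 elements, M_eps(a, b) is multiplication
   by a + b sqrt eps and J is the Frobenius; as p = 2 mod 3, Frobenius inverts
   the cubic residue classes, so G_0(p) fuses the two nontrivial ones. *)
Require Import Defs.
From HB Require Import structures.
From mathcomp Require Import all_boot all_order all_fingroup all_algebra.
From mathcomp Require Import all_solvable all_field.
From mathcomp Require Import ring.

Set Implicit Arguments.
Unset Strict Implicit.
Unset Printing Implicit Defensive.

Import GRing.Theory.
Local Open Scope ring_scope.

(** * Conjugates of algebraic numbers *)

Lemma map_poly_in_alg (Q : fieldExtType rat) (QC : {rmorphism Q -> algC}) p :
  map_poly QC (map_poly (in_alg Q) p) = map_poly ratr p.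
Proof.
rewrite -map_poly_comp; apply: eq_map_poly => a.
by rewrite /= rmorphZ_num rmorph1 mulr1.
Qed.

(** Both polynomials are monic with rational coefficients and vanish at the same element, so by
    minimality each divides the other. *)
Lemma map_minPoly_algC (Q : fieldExtType rat) (QC : {rmorphism Q -> algC}) x :
  map_poly QC (minPoly 1 x) = minCpoly (QC x).
Proof.
have [p [Dp mon_p] dv_p] := minCpolyP (QC x).
have [q Dq] := polyOver1P (minPolyOver 1 x).
apply/eqP; rewrite -eqp_monic ?minCpoly_monic ?monic_map ?monic_minPoly //.
rewrite Dp Dq map_poly_in_alg /eqp !dvdp_map -dv_p.
rewrite -(map_poly_in_alg QC) -Dq fmorph_root root_minPoly andbT.
rewrite -(dvdp_map (in_alg Q)) -Dq; apply: minPoly_dvdp.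
  by apply/polyOver1P; exists p.
by rewrite -(fmorph_root QC) map_poly_in_alg -Dp root_minCpoly.
Qed.

(** Inside the number field generated by all roots of [minCpoly z], the embedding sending [z] to [w]
    extends to the whole field because it is a splitting field. That automorphism then extends to
    [algC]. *)
Lemma minCpoly_root_aut z w :
  root (minCpoly z) w -> exists nu : {rmorphism algC -> algC}, nu z = w.
Proof.
move=> wroot.
have [r Dr] := closed_field_poly_normal (minCpoly z : {poly algC}).
rewrite (monicP (minCpoly_monic z)) scale1r in Dr.
have rz : z \in r by rewrite -root_prod_XsubC -Dr root_minCpoly.
have rw : w \in r by rewrite -root_prod_XsubC -Dr.
have [Q [QC [rr Drr genQ]]] := num_field_exists r.
rewrite -Drr in rz rw.
have /mapP[zz zzr Dz] := rz; have /mapP[ww wwr Dw] := rw.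
pose phi := kHomExtend 1 \1 zz ww.
have hom1 : kHom 1 1 (\1%VF : 'End(Q)) by rewrite kHom1.
have pzw : root (map_poly \1%VF (minPoly 1 zz)) ww.
  rewrite map_poly_id => [|? _]; last by rewrite id_lfunE.
  by rewrite -(fmorph_root QC) map_minPoly_algC -Dz -Dw.
have hom_phi : kHom 1 <<1; zz>> phi := kHomExtendP (sub1v _) hom1 pzw.
have split_Q : splittingFieldFor <<1; zz>> (minPoly 1 zz) fullv.
  apply: splittingFieldForS (sub1v _) (subvf _) _; exists rr => //.
  congr (_ %= _): (eqpxx (minPoly 1 zz)); apply/(map_poly_inj QC).
  rewrite map_minPoly_algC -Dz Dr -Drr big_map rmorph_prod /=.
  by apply: eq_bigr => x _; rewrite map_polyXsubC.
have [f aut_f Df] :=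
  kHom_extends (sub1v _) hom_phi (minPolyOver 1 zz) split_Q.
pose fmM := GRing.isMonoidMorphism.Build _ _ f (kHom_monoid_morphism aut_f).
pose fM : {rmorphism _ -> _} := HB.pack (fun_of_lfun f) fmM.
have [nu Dnu] := extend_algC_subfield_aut QC fM.
exists nu; rewrite Dz -Dnu /= -Df ?memv_adjoin // Dw.
by rewrite /phi (kHomExtend_val hom1 pzw).
Qed.

Lemma minCpoly_aut_root (nu : {rmorphism algC -> algC}) z :
  root (minCpoly z) (nu z).
Proof.
have [p [Dp _] _] := minCpolyP z.
rewrite Dp -(eq_map_poly (fmorph_rat nu)) map_poly_comp fmorph_root -Dp.
exact: root_minCpoly.
Qed.

(** The roots are simple because minimal polynomials are separable in characteristic 0. Separability
    is proved in an abstract number field containing [z] and transported to [algC]. *)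
Lemma minCpoly_roots z :
  exists2 r : seq algC, uniq r & minCpoly z = \prod_(x <- r) ('X - x%:P).
Proof.
have [r Dr] := closed_field_poly_normal (minCpoly z : {poly algC}).
rewrite (monicP (minCpoly_monic z)) scale1r in Dr.
exists r => //.
have [Q [QC [[|zz []] // [Dz] _]]] := num_field_exists [:: z].
rewrite -separable_prod_XsubC -Dr -Dz -map_minPoly_algC separable_map.
apply: pcharf0_separable => p; rewrite pchar_lalg.
exact: Num.Theory.pchar_num.
Qed.

(** The weights [a] let [nu z] be computed from the images of [s], and the polynomials [ps] recover
    those images from [nu z]. Hence conjugates of the whole sequence and conjugates of [z] determine
    each other. *)
Lemma primitive_element_algC (s : seq algC) :
  exists z (a : 'I_(size s) -> nat) (ps : seq {poly rat}),
   [/\ s = [seq (map_poly ratr p).[z] | p <- ps],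
     forall nu : {rmorphism algC -> algC},
       nu z = \sum_(i < size s) nu s`_i *+ a i &
     \dim {: adjoin_algC s} = (size (minCpoly z)).-1].
Proof.
rewrite /adjoin_algC; case: num_field_exists => Q [QC [s1 Ds1 genQ]] /=.
have [z [a Dz] [ps Ds]] := algC_PET s.
have sz_s : size s1 = size s by rewrite -Ds1 size_map.
exists z, a, ps; split=> //.
  by move=> nu; rewrite Dz rmorph_sum; apply: eq_bigr => i _; rewrite rmorphMn.
pose z1 := \sum_(i < size s) s1`_i *+ a i.
have Dz1 : z = QC z1.
  rewrite Dz rmorph_sum; apply: eq_bigr => i _ /=.
  by rewrite rmorphMn /= -(nth_map _ 0) ?sz_s // Ds1.
(* [z1] generates [Q], since each generator in [s1] is a rational polynomial in [z1]. *)
have -> : \dim {:Q} = adjoin_degree 1 z1.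
  rewrite adjoin_degreeE dimv1 divn1; congr (\dim _).
  apply/eqP; rewrite eqEsubv subvf andbT -genQ.
  apply/Fadjoin_seqP; split; first exact: sub1v.
  move=> x s1x; have: QC x \in s by rewrite -Ds1 map_f.
  rewrite {1}Ds => /mapP[p _]; rewrite Dz1 -(map_poly_in_alg QC) horner_map.
  move/fmorph_inj->; apply: mempx_Fadjoin.
  by apply/polyOver1P; exists p.
by rewrite Dz1 -map_minPoly_algC size_map_poly size_minPoly.
Qed.

(** * Degrees of torsion points as orbit sizes *)

(** The set [O] indexes the conjugates of [P]. Sending a conjugate of [P] to the corresponding
    conjugate of a primitive element is a bijection onto the roots of the minimal polynomial, and
    these are simple. *)
Lemma point_degree_card (T : finType) (O : {set T}) (f : T -> point algC) P :
    P <> Inf -> {in O &, injective f} ->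
    (forall nu : {rmorphism algC -> algC},
       exists2 u, u \in O & map_point nu P = f u) ->
    (forall u, u \in O -> exists nu : {rmorphism algC -> algC},
       f u = map_point nu P) ->
  point_degree P = #|O|.
Proof.
case: P => [|x y] // _ f_inj PO OP; rewrite /point_degree /=.
have [z [a [ps [Dps Dz ->]]]] := primitive_element_algC [:: x; y].
have [r r_uniq Dr] := minCpoly_roots z.
(* The primitive element as a function of the point. The value at [Inf] is a dummy, as conjugates of
   an affine point are affine. *)
pose zc (P : point algC) :=
  if P is Aff x1 y1 then \sum_(i < 2) [:: x1; y1]`_i *+ a i else 0.
have zcP (nu : {rmorphism algC -> algC}) : zc (map_point nu (Aff x y)) = nu z.
  by rewrite Dz; apply: eq_bigr => -[[|[|]]].
rewrite Dr size_prod_XsubC /= cardE -(size_map (zc \o f)).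
apply/esym/perm_size/uniq_perm => //.
  rewrite map_inj_in_uniq ?enum_uniq // => u1 u2; rewrite !mem_enum => Ou1 Ou2.
  have [nu1 D1] := OP u1 Ou1; have [nu2 D2] := OP u2 Ou2.
  rewrite /= D1 D2 !zcP => eq_z; apply: f_inj => //; rewrite D1 D2 /=.
  (* The coordinates are rational polynomials in [z], so [nu1 z = nu2 z] forces agreement on
     them. *)
  have nuP c : c \in [:: x; y] -> nu1 c = nu2 c.
    rewrite Dps => /mapP[p _ ->].
    rewrite -!horner_map /= -!map_poly_comp !(eq_map_poly (fmorph_rat _)).
    by rewrite eq_z.
  by rewrite !nuP ?inE ?eqxx ?orbT.
move=> w; apply/mapP/idP => [[u] | rw].
  rewrite mem_enum => /OP[nu Du] ->.
  by rewrite /= Du zcP -root_prod_XsubC -Dr minCpoly_aut_root.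
have [|nu Dw] := @minCpoly_root_aut z w; first by rewrite Dr root_prod_XsubC.
have [u Ou Du] := PO nu.
by exists u; rewrite ?mem_enum //= -Du zcP.
Qed.

(** * Compatibility of the chord and tangent law with field morphisms *)

Section Functoriality.

Variables (F K : fieldType) (nu : {rmorphism F -> K}) (W : weierstrass F).
Let nuW := map_weierstrass nu W.
Implicit Types P Q : point F.

Lemma map_chord (l x1 y1 x2 : F) :
  map_point nu (chord W l x1 y1 x2) = chord nuW (nu l) (nu x1) (nu y1) (nu x2).
Proof.
by congr Aff; rewrite !(rmorphB, rmorphN, rmorphD, rmorphM, rmorphXn).
Qed.

(** The law consists of rational functions and equality tests. Field morphisms preserve both, the
    tests by injectivity. *)
Lemma map_padd P Q :
  map_point nu (padd W P Q) = padd nuW (map_point nu P) (map_point nu Q).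
Proof.
case: P Q => [|x1 y1] [|x2 y2] //=.
rewrite (inj_eq (fmorph_inj nu)) -!rmorphM -!rmorphD fmorph_eq0.
case: ifP => _; last (case: ifP => _ //).
  by rewrite map_chord fmorph_div !rmorphB.
rewrite map_chord fmorph_div.
by rewrite !(rmorph_nat, rmorphB, rmorphXn, rmorphD, rmorphM).
Qed.

Lemma map_pmul n P : map_point nu (pmul W n P) = pmul nuW n (map_point nu P).
Proof. by elim: n => //= n IHn; rewrite map_padd IHn. Qed.

Lemma map_on_curve P : on_curve W P -> on_curve nuW (map_point nu P).
Proof.
case: P => [|x y] //= /(congr1 nu).
by rewrite !(rmorphD, rmorphM, rmorphXn).
Qed.

End Functoriality.

(** * The Galois action on [E[p]] in coordinates *)

Section Galois.

Variables (E : elliptic_curve rat) (p : nat).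
Let EC : weierstrass algC := map_weierstrass ratr E.
Implicit Types (nu : {rmorphism algC -> algC}) (P Q : point algC).

Let map_EC nu : map_weierstrass nu EC = EC.
Proof. by congr Weierstrass; rewrite /= fmorph_rat. Qed.

Lemma map_comb nu P1 P2 (v : 'cV['F_p]_2) :
  map_point nu (comb E P1 P2 v) = comb E (map_point nu P1) (map_point nu P2) v.
Proof. by rewrite /comb map_padd !map_pmul map_EC. Qed.

Lemma map_torsion nu P : torsion E p P -> torsion E p (map_point nu P).
Proof.
rewrite /torsion -/EC -(map_EC nu) => -[onP pP].
rewrite map_EC in onP pP; split; first exact: map_on_curve.
by rewrite -map_pmul pP.
Qed.

Variables (P1 P2 : point algC).
Hypothesis basisP : torsion_basis E p P1 P2.
Let f := @comb E p P1 P2.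

Let combD : {morph f : u v / u + v >-> padd EC u v}.
Proof. by case: basisP. Qed.

Let comb_inj : injective f. Proof. by case: basisP. Qed.

Let torsionP P : torsion E p P <-> exists v, P = f v.
Proof. by case: basisP. Qed.

Let comb0 : f 0 = Inf. Proof. by rewrite /f /comb !mxE. Qed.

Let pmul_comb n v : pmul EC n (f v) = f (v *+ n).
Proof. by elim: n => [|n IHn]; rewrite /= ?comb0 // IHn -combD mulrS. Qed.

(** Multiples and sums of torsion points are computed in F_p^2, by additivity of [comb]. *)
Let comb_lin (P' Q' : 'cV['F_p]_2) (v : 'cV['F_p]_2) :
  comb E (f P') (f Q') v = f (v 0 0 *: P' + v 1 0 *: Q').
Proof.
rewrite /comb !pmul_comb -combD; congr (f (_ + _)).
  by rewrite -scaler_nat natr_Zp.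
by rewrite -scaler_nat natr_Zp.
Qed.

Let pmul1 P : pmul EC 1 P = P.
Proof. by case: P. Qed.

Let comb_e0 : f (delta_mx 0 0) = P1.
Proof.
by rewrite /f /comb !mxE (pmul1 P1); case: P1.
Qed.

Let comb_e1 : f (delta_mx 1 0) = P2.
Proof.
by rewrite /f /comb !mxE (pmul1 P2).
Qed.

(** The matrix prescribes the images of the basis only. The equation of [E] is rational, so [nu]
    respects the group law and acts linearly on coordinates. *)
Lemma galois_matrix_comb nu g v : galois_matrix E P1 P2 nu g ->
  map_point nu (f v) = f (g *m v).
Proof.
case=> D1 D2; rewrite map_comb D1 D2 comb_lin; congr f.
apply/matrixP=> i j; rewrite !mxE !big_ord_recl big_ord0 addr0 !ord1.
rewrite [v 0 0 * _]mulrC [v 1 0 * _]mulrC.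
by congr (_ * _ + g _ _ * v _ _); apply: val_inj.
Qed.

Lemma galois_matrix_exists nu :
  exists g : 'M['F_p]_2, galois_matrix E P1 P2 nu g.
Proof.
have tor v : torsion E p (f v) by apply/torsionP; exists v.
have [|v1 D1] := (torsionP (map_point nu P1)).1.
  by apply: map_torsion; rewrite -comb_e0.
have [|v2 D2] := (torsionP (map_point nu P2)).1.
  by apply: map_torsion; rewrite -comb_e1.
exists (\matrix_(i, j) if j == 0 then v1 i 0 else v2 i 0).
split; rewrite ?D1 ?D2; congr f; apply/matrixP=> i j; rewrite !mxE ord1 //.
Qed.

(** The conjugates of [f v] are the points [f (g *m v)] with [g] in [G], and [f] is injective, so
    the orbit of [v] serves as index set. *)
Lemma point_degree_comb (G : {set 'M['F_p]_2}) v :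
    (forall g, in_galois_image E P1 P2 g <-> g \in G) -> v != 0 ->
  point_degree (f v) = #|[set g *m v | g in G]|.
Proof.
move=> imG nz_v; apply: (@point_degree_card _ _ f) => [| u w _ _|nu|u].
- by rewrite -comb0 => /comb_inj/eqP; apply/negP.
- exact: comb_inj.
- have [g Dg] := galois_matrix_exists nu.
  exists (g *m v); last exact: galois_matrix_comb.
  apply: imset_f; apply/imG; exists nu; split=> //.
  (* Every ring endomorphism of [algC] is bijective, so [nu] is a genuine Galois element. *)
  by exists (algC_invaut nu); [apply: algC_autK | apply: algC_invautK].
case/imsetP=> g /imG[nu [_ Dg]] ->.
by exists nu; rewrite (galois_matrix_comb _ Dg).
Qed.

End Galois.

(** Reduces the theorem to linear algebra over F_p: only orbit sizes of explicit matrix groups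
    remain to be found. *)
Lemma torsion_degrees_orbits E p (G : {set 'M['F_p]_2}) ds :
    galois_image_is E G ->
    (forall v : 'cV['F_p]_2, v != 0 -> #|[set g *m v | g in G]| \in ds) ->
    (forall d, d \in ds ->
       exists2 v : 'cV['F_p]_2, v != 0 & #|[set g *m v | g in G]| = d) ->
  torsion_degrees_are E p ds.
Proof.
move=> [P1 [P2 [basisP imG]]] ds_orbit orbit_ds d.
have comb0 : comb E P1 P2 (0 : 'cV['F_p]_2) = Inf by rewrite /comb !mxE.
have [_ comb_inj torsionP] := basisP.
split=> [[P [/torsionP[v ->] nzP <-]] | /orbit_ds[v nz_v <-]].
  have nz_v : v != 0 by apply/eqP=> v0; case: nzP; rewrite v0.
  by rewrite (point_degree_comb basisP imG) ?ds_orbit.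
exists (comb E P1 P2 v); split; first by apply/torsionP; exists v.
  by rewrite -comb0 => /comb_inj/eqP; apply/negP.
exact: point_degree_comb.
Qed.

(** * Powers in finite fields *)

Section FiniteField.

Variable F : finFieldType.
Implicit Types x y : F.

Lemma expf_card_pred x : x != 0 -> x ^+ #|F|.-1 = 1.
Proof.
move=> nz_x; apply: (mulfI nz_x).
by rewrite -exprS prednK ?expf_card ?mulr1 // ltnW ?finNzRing_gt1.
Qed.

Lemma finField_prim_root : exists z : F, (#|F|.-1).-primitive_root z.
Proof.
have q1_gt0 : (0 < #|F|.-1)%N.
  by rewrite -ltnS prednK ?finNzRing_gt1 // ltnW ?finNzRing_gt1.
have /hasP[z _ prim_z] : has (#|F|.-1).-primitive_root (enum [set~ (0 : F)]).
  apply: has_prim_root; rewrite ?enum_uniq -?cardE ?cardsC1 //.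
  apply/allP=> x; rewrite mem_enum !inE => nz_x.
  by apply/unity_rootP/expf_card_pred.
by exists z.
Qed.

(** In a cyclic group of order [m * n], writing [x] as a power of a generator, [x ^+ m = 1] forces
    [n] to divide the exponent. This is Euler's criterion for [n = 2] and its cubic analogue for
    [n = 3]. *)
Lemma unity_root_exp m n x : #|F|.-1 = (m * n)%N -> x ^+ m = 1 ->
  exists2 y, y != 0 & x = y ^+ n.
Proof.
move=> Dq xm1; have [z prim_z] := finField_prim_root.
have q1_gt0 := prim_order_gt0 prim_z.
have /andP[m_gt0 n_gt0] : (0 < m)%N && (0 < n)%N by rewrite -muln_gt0 -Dq.
have [|i Dx] := prim_rootP prim_z (x := x).
  by rewrite Dq exprM xm1 expr1n.
have : (n %| i)%N.
  rewrite -(dvdn_pmul2l m_gt0) -Dq (prim_order_dvd prim_z) mulnC exprM -Dx.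
  by rewrite xm1.
case/dvdnP=> k Di; exists (z ^+ k); last by rewrite Dx Di exprM.
rewrite expf_neq0 //; apply/eqP=> z0; move: (prim_expr_order prim_z).
by rewrite z0 expr0n gtn_eqF // => /esym/eqP; rewrite oner_eq0.
Qed.

(** When [#|F|.-1 = m * n], this is the group of nonzero [n]-th powers, in a form that is easy to
    count. *)
Definition unity_roots m : {set F} := [set x | x ^+ m == 1].

Lemma unity_roots_neq0 m x : (0 < m)%N -> x \in unity_roots m -> x != 0.
Proof.
move=> m_gt0; rewrite inE; apply: contraTneq => ->.
by rewrite expr0n gtn_eqF // eq_sym oner_eq0.
Qed.

Lemma card_unity_roots m n : #|F|.-1 = (m * n)%N -> #|unity_roots m| = m.
Proof.
move=> Dq; have [z prim_z] := finField_prim_root.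
have q1_gt0 := prim_order_gt0 prim_z.
have prim_zn : m.-primitive_root (z ^+ n).
  have -> : m = (#|F|.-1 %/ gcdn n #|F|.-1)%N.
    have n_gt0 : (0 < n)%N by move: q1_gt0; rewrite Dq muln_gt0 => /andP[].
    by rewrite Dq gcdnMl mulnK.
  exact: exp_prim_root.
pose h (i : 'I_m) := (z ^+ n) ^+ i.
have h_inj : injective h.
  move=> i j /eqP; rewrite (eq_prim_root_expr prim_zn) !modn_small //.
  by move/eqP/val_inj.
rewrite -[RHS]card_ord -cardsT -(card_imset _ h_inj); apply: eq_card => x.
rewrite inE; apply/eqP/imsetP=> [/(prim_rootP prim_zn)[i ->] | [i _ ->]].
  by exists i.
by rewrite -exprM mulnC exprM (prim_expr_order prim_zn) expr1n.
Qed.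

(** A generator has order [m * n > m]. It provides nonsquares and noncubes. *)
Lemma exists_nonroot m n : (1 < n)%N -> #|F|.-1 = (m * n)%N ->
  exists2 x : F, x != 0 & x ^+ m != 1.
Proof.
move=> n_gt1 Dq; have [z prim_z] := finField_prim_root.
have q1_gt0 := prim_order_gt0 prim_z.
have m_gt0 : (0 < m)%N by move: q1_gt0; rewrite Dq muln_gt0 => /andP[].
exists z; last first.
  rewrite -(prim_order_dvd prim_z) gtnNdvd // Dq.
  by rewrite -{1}[m]muln1 ltn_pmul2l.
apply/eqP=> z0; move: (prim_expr_order prim_z).
by rewrite z0 expr0n gtn_eqF // => /esym/eqP; rewrite oner_eq0.
Qed.

End FiniteField.

(** * Orbits of the subgroups *)

Section Orbits.

Variable p : nat.
Hypothesis p_pr : prime p.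
Local Notation F := 'F_p.
Local Notation V := ('cV[F]_2).

Definition colv (x y : F) : V := \col_i (if i == 0 then x else y).

Lemma colvE (v : V) : v = colv (v 0 0) (v 1 0).
Proof.
by apply/colP=> -[[|[|]]] //= i; rewrite mxE /=; congr (v _ _); apply: val_inj.
Qed.

Lemma colv_inj x y x' y' : colv x y = colv x' y' -> x = x' /\ y = y'.
Proof.
by move/colP=> eq_v; have:= eq_v 0; have:= eq_v 1; rewrite !mxE.
Qed.

Lemma colv_eq0 x y : (colv x y == 0) = (x == 0) && (y == 0).
Proof.
apply/eqP/andP=> [|[/eqP-> /eqP->]]; last first.
  by apply/colP=> i; rewrite !mxE if_same.
have -> : 0 = colv 0 0 by apply/colP=> i; rewrite !mxE if_same.
by case/colv_inj=> -> ->.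
Qed.

Lemma mul_mx22_colv (a b c d x y : F) :
  mx22 a b c d *m colv x y = colv (a * x + b * y) (c * x + d * y).
Proof.
apply/colP=> i; rewrite !mxE !big_ord_recl big_ord0 addr0 !mxE /=.
by case: ifP.
Qed.

Lemma mul_mx22 (a b c d a' b' c' d' : F) :
  mx22 a b c d *m mx22 a' b' c' d' =
  mx22 (a * a' + b * c') (a * b' + b * d') (c * a' + d * c') (c * b' + d * d').
Proof.
apply/matrixP=> i j; rewrite !mxE !big_ord_recl big_ord0 addr0 !mxE /=.
by case: ifP; case: ifP.
Qed.

(** Orbits are counted after being described as a set of coordinate pairs. *)
Lemma card_orbit_colv (G : {set 'M[F]_2}) v (S : {set F * F}) :
    (forall x y, (exists2 g, g \in G & g *m v = colv x y) <-> (x, y) \in S) ->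
  #|[set g *m v | g in G]| = #|S|.
Proof.
move=> GS; rewrite -(card_imset S (f := fun u => colv u.1 u.2)); last first.
  by case=> x y [x' y'] /= /colv_inj[-> ->].
apply: eq_card => w; apply/imsetP/imsetP=> [[g Gg Dw] | [[x y] Su ->]] /=.
  exists (w 0 0, w 1 0); last by rewrite /= -colvE.
  by apply/GS; exists g; rewrite // -Dw -colvE.
by have [g Gg Dg] := (GS x y).2 Su; exists g.
Qed.

Lemma card_Fp_unit : #|[set~ (0 : F)]| = (p - 1)%N.
Proof. by rewrite cardsC1 card_Fp // subn1. Qed.

Lemma card_vec_neq0 : #|[set~ ((0, 0) : F * F)]| = (p ^ 2 - 1)%N.
Proof. by rewrite cardsC1 card_prod !card_Fp // subn1. Qed.

Lemma card_axes :
  #|[set u : F * F | (u.1 == 0) (+) (u.2 == 0)]| = (2 * (p - 1))%N.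
Proof.
have -> : [set u : F * F | (u.1 == 0) (+) (u.2 == 0)]
    = setX [set 0] [set~ 0] :|: setX [set~ 0] [set 0].
  by apply/setP=> -[x y]; rewrite !inE; case: eqP; case: eqP.
rewrite cardsU !cardsX !card_Fp_unit !cards1.
rewrite (_ : _ :&: _ = set0) ?cards0 ?subn0 ?mul1n ?muln1 ?mul2n ?addnn //.
by apply/setP=> -[x y]; rewrite !inE; case: eqP; case: eqP.
Qed.

(** Such vectors are parametrized bijectively by [(x, r)] going to [(x, x * r)], with [x] nonzero
    and [r] in [R]. *)
Lemma card_slopes (R : {set F}) :
  #|[set u : F * F | (u.1 != 0) && (u.2 / u.1 \in R)]| = ((p - 1) * #|R|)%N.
Proof.
rewrite -card_Fp_unit -cardsX.
rewrite -[RHS](card_in_imset (f := fun u : F * F => (u.1, u.1 * u.2))).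
  apply: eq_card => -[x y]; rewrite inE /=.
  apply/andP/imsetP=> [[nz_x Rxy] | [[x' r]]].
    by exists (x, y / x); rewrite ?inE ?nz_x //= mulrCA divff ?mulr1.
  rewrite !inE => /andP[nz_x Rr] [-> ->]; split=> //=.
  by rewrite mulrAC divff ?mul1r.
move=> [x r] [x' r']; rewrite !inE /= => /andP[nz_x _] _ eq_xr.
have /= eq_x := congr1 fst eq_xr; have /= eq_r := congr1 snd eq_xr.
rewrite -eq_x in eq_r *.
by rewrite (mulfI nz_x eq_r).
Qed.


Lemma mx22_1 : mx22 1 0 0 1 = 1%:M :> 'M[F]_2.
Proof. by apply/matrixP=> -[[|[|//]] ?] [[|[|//]] ?]; rewrite !mxE. Qed.

(** A nonzero vector is completed to a basis, which makes the action of [GL2] on nonzero vectors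
    transitive. *)
Lemma unitmx_first_col x y : colv x y != 0 ->
  exists2 A : 'M[F]_2, A \in unitmx & A *m colv 1 0 = colv x y.
Proof.
rewrite colv_eq0 negb_and; have [-> /= nz_y | nz_x _] := eqVneq x 0.
  exists (mx22 0 1 y 0); last first.
    by rewrite mul_mx22_colv !(mulr1, mulr0, addr0).
  have /mulmx1_unit[] // : mx22 0 1 y 0 *m mx22 0 y^-1 1 0 = 1%:M.
  by rewrite -mx22_1 mul_mx22; congr mx22; field.
exists (mx22 x 0 y 1); last first.
  by rewrite mul_mx22_colv !(mulr1, mulr0, addr0).
have /mulmx1_unit[] // : mx22 x 0 y 1 *m mx22 x^-1 0 (- y / x) 1 = 1%:M.
by rewrite -mx22_1 mul_mx22; congr mx22; field.
Qed.

Lemma orbit_GL2 x y : colv x y != 0 ->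
  #|[set g *m colv x y | g in GL2 p]| = (p ^ 2 - 1)%N.
Proof.
move=> nz_v; rewrite -card_vec_neq0; apply: card_orbit_colv => x' y'.
rewrite !inE -pair_eqE /= -colv_eq0; split=> [[g] | nz_v'].
  rewrite inE => Ug <-; apply: contra nz_v => /eqP gv0.
  by rewrite -(mulKmx Ug (colv x y)) gv0 mulmx0.
have [A UA <-] := unitmx_first_col nz_v.
have [B UB <-] := unitmx_first_col nz_v'.
exists (B *m invmx A); first by rewrite inE unitmx_mul UB unitmx_inv.
by rewrite -mulmxA mulKmx.
Qed.

Lemma exists_eq_orP (P : F -> F -> bool) (f h : F -> F -> 'M[F]_2) g :
  reflect (exists a b, P a b /\ (g = f a b \/ g = h a b))
    [exists a, exists b, P a b && ((g == f a b) || (g == h a b))].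
Proof.
apply: (iffP existsP) => [[a /existsP[b /andP[Pab]]] | [a [b [Pab Dg]]]].
  by case/orP=> /eqP->; exists a, b; split; auto.
exists a; apply/existsP; exists b; rewrite Pab.
by case: Dg => ->; rewrite eqxx ?orbT.
Qed.

Lemma exists_neq0_eq_orP (f h : F -> F -> 'M[F]_2) g :
  reflect (exists a b, [/\ a != 0, b != 0 & g = f a b \/ g = h a b])
    [exists a, exists b,
       [&& a != 0, b != 0 & (g == f a b) || (g == h a b)]].
Proof.
apply: (iffP existsP) => [[a /existsP[b]] | [a [b [nz_a nz_b Dg]]]].
  by case/and3P=> nz_a nz_b /orP[] /eqP->; exists a, b; split; auto.
exists a; apply/existsP; exists b; rewrite nz_a nz_b.
by case: Dg => ->; rewrite eqxx ?orbT.
Qed.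

Lemma mem_Cnsp g : reflect (exists a b, (a, b) != (0, 0) /\
  (g = Mmx a b \/ g = Jmx p *m Mmx a b)) (g \in Cnsp p).
Proof. by rewrite inE; apply: exists_eq_orP. Qed.

Lemma mem_Csp g : reflect (exists a b, [/\ a != 0, b != 0 &
  g = Dmx a b \/ g = Tmx p *m Dmx a b]) (g \in Csp p).
Proof. by rewrite inE; apply: exists_neq0_eq_orP. Qed.

Lemma mem_G00 g : reflect (exists a b, a != 0 /\
  (g = mx22 a b 0 a \/ g = mx22 a b 0 (- a))) (g \in G00 p).
Proof. by rewrite inE; apply: exists_eq_orP. Qed.

Lemma mem_G10 g : reflect (exists c b, c != 0 /\
  (g = mx22 (c ^+ 2) b 0 (c ^+ 2) \/ g = mx22 (c ^+ 2) b 0 (- c ^+ 2)))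
  (g \in G10 p).
Proof. by rewrite inE; apply: exists_eq_orP. Qed.

Lemma mem_G01 g : reflect (exists c b, c != 0 /\
  (g = mx22 (c ^+ 2) b 0 (c ^+ 2) \/ g = mx22 (- c ^+ 2) b 0 (c ^+ 2)))
  (g \in G01 p).
Proof. by rewrite inE; apply: exists_eq_orP. Qed.

Lemma mem_G3 g : reflect (exists a b, [/\ a != 0, b != 0 &
  g = Dmx a (a * b ^+ 3) \/ g = Tmx p *m Dmx a (a * b ^+ 3)]) (g \in G3 p).
Proof. by rewrite inE; apply: exists_neq0_eq_orP. Qed.

Lemma mem_G0 g : reflect (exists a b, (a, b) != (0, 0) /\
  (g = Mmx a b ^+ 3 \/ g = Jmx p *m Mmx a b ^+ 3)) (g \in G0 p).
Proof. by rewrite inE; apply: exists_eq_orP. Qed.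

Lemma mul_Dmx_colv a b x y : Dmx a b *m colv x y = colv (a * x) (b * y).
Proof. by rewrite mul_mx22_colv !mul0r addr0 add0r. Qed.

Lemma mul_Tmx_colv x y : Tmx p *m colv x y = colv y x.
Proof. by rewrite mul_mx22_colv !mul0r !mul1r addr0 add0r. Qed.

Lemma mul_Jmx_colv x y : Jmx p *m colv x y = colv x (- y).
Proof. by rewrite mul_mx22_colv !mul0r mul1r mulN1r addr0 add0r. Qed.

Lemma mul_Mmx_colv a b x y :
  Mmx a b *m colv x y = colv (a * x + b * eps p * y) (b * x + a * y).
Proof. exact: mul_mx22_colv. Qed.

Lemma Fp_odd_order : odd p -> #|F|.-1 = (p./2 * 2)%N.
Proof.
move=> p_odd; rewrite card_Fp // muln2.
by rewrite -{1}(odd_double_half p) p_odd.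
Qed.

Lemma Fp_two_neq0 : odd p -> 2%:R != 0 :> F.
Proof.
move=> p_odd; rewrite -(dvdn_pcharf (pchar_Fp p_pr)).
by rewrite dvdn_prime2 //; apply: contraTneq p_odd => ->.
Qed.

Lemma Fp_m1_neq1 : odd p -> -1 != 1 :> F.
Proof.
move/Fp_two_neq0; apply: contra => /eqP m1.
by rewrite -[2%:R]/(1 + 1) -{1}m1 addNr.
Qed.

Lemma square_half_exp (t : F) : odd p -> t != 0 -> (t ^+ 2) ^+ p./2 = 1.
Proof.
by move=> p_odd nz_t; rewrite -exprM mulnC -Fp_odd_order ?expf_card_pred.
Qed.

Lemma m1_half_exp : (p %% 4 = 3)%N -> (-1 : F) ^+ p./2 = -1.
Proof.
(* If p = 4k + 3 then [p./2] is 2k + 1. *)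
move=> p3; rewrite -signr_odd (_ : odd p./2) //.
rewrite (divn_eq p 4) p3 (_ : 4 = 2 * 2)%N // mulnA muln2 halfD odd_double /=.
by rewrite doubleK add0n addnC muln2 /= odd_double.
Qed.

(** If p = 3 mod 4, -1 fails Euler's criterion. Otherwise [eps] is the head of a list of nonsquares,
    which is shown to be nonempty. *)
Lemma eps_nonsquare (t : F) : odd p -> t ^+ 2 != eps p.
Proof.
move=> p_odd; rewrite /eps; have [/eqP p3|_] := ifPn.
  apply/eqP=> t2; move/eqP: (m1_half_exp p3).
  rewrite -{1}t2 square_half_exp //.
    by rewrite eq_sym (negPf (Fp_m1_neq1 p_odd)).
  by apply/eqP=> t0; move/eqP: t2; rewrite t0 expr0n eq_sym oppr_eq0 oner_eq0.
set s := [seq n <- _ | _].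
have [x nz_x nsq_x] := exists_nonroot (isT : 1 < 2)%N (Fp_odd_order p_odd).
have nsq (u : F) : u ^+ 2 != x.
  apply/eqP=> u2; case/eqP: nsq_x; rewrite -u2 square_half_exp //.
  by apply: contra nz_x => /eqP u0; rewrite -u2 u0 expr0n.
(* A nonsquare residue is neither 0 nor 1 and is less than p, hence lies in the range searched; the
   default value of [head] is not reached. *)
have s_x : (x : nat) \in s.
  rewrite mem_filter mem_iota; apply/and3P; split.
  - by apply/existsPn=> u; rewrite natr_Zp.
  - case: (x : nat) (natr_Zp x) => [|[|//]] Dx.
      by have := nsq 0; rewrite -Dx expr0n eqxx.
    by have := nsq 1; rewrite -Dx expr1n eqxx.
  - apply: leq_trans (ltn_ord x) _.
    by rewrite Fp_cast // leq_addl.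
have : head 0%N s \in s by case: (s) s_x => //= n s' _; rewrite mem_head.
by rewrite mem_filter => /andP[/existsPn/(_ t)].
Qed.

(** This is the norm form of F_p(sqrt eps); a nontrivial zero would make [eps] the square of
    [x / y]. *)
Lemma eps_norm_eq0 x y : odd p ->
  (x ^+ 2 - eps p * y ^+ 2 == 0) = (colv x y == 0).
Proof.
move=> p_odd; rewrite colv_eq0.
have [-> | nz_y] := eqVneq y 0.
  by rewrite expr0n mulr0 subr0 sqrf_eq0 andbT.
rewrite andbF subr_eq0; apply/eqP=> Dx.
case/eqP: (eps_nonsquare (x / y) p_odd).
by rewrite expr_div_n Dx mulfK // sqrf_eq0.
Qed.

Lemma orbit_Cnsp x y : odd p -> colv x y != 0 ->
  #|[set g *m colv x y | g in Cnsp p]| = (p ^ 2 - 1)%N.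
Proof.
move=> p_odd nz_v; rewrite -card_vec_neq0; apply: card_orbit_colv => x' y'.
rewrite !inE -pair_eqE /= -colv_eq0; split=> [[g /mem_Cnsp[a [b []]]] | nz_v'].
  rewrite -pair_eqE /= -colv_eq0 -!eps_norm_eq0 // in nz_v * => nz_ab.
  case=> ->; rewrite -?mulmxA mul_Mmx_colv ?mul_Jmx_colv => /colv_inj[<- <-].
    (* Multiplicativity of the norm keeps the image nonzero; [Jmx] is conjugation and preserves the
       norm. *)
    rewrite (_ : _ - _ =
      (a ^+ 2 - eps p * b ^+ 2) * (x ^+ 2 - eps p * y ^+ 2)); last by ring.
    by rewrite mulf_neq0.
  rewrite (_ : _ - _ =
    (a ^+ 2 - eps p * b ^+ 2) * (x ^+ 2 - eps p * y ^+ 2)); last by ring.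
  by rewrite mulf_neq0.
have nz_N : x ^+ 2 - eps p * y ^+ 2 != 0 by rewrite eps_norm_eq0.
(* [a] and [b] are the coordinates of the quotient of x' + y' sqrt eps by x + y sqrt eps, the
   denominator being cleared by its conjugate. *)
pose a := (x * x' - eps p * y * y') / (x ^+ 2 - eps p * y ^+ 2).
pose b := (x * y' - y * x') / (x ^+ 2 - eps p * y ^+ 2).
have Mv : Mmx a b *m colv x y = colv x' y'.
  by rewrite mul_Mmx_colv; congr colv; rewrite /a /b; field.
exists (Mmx a b) => //; apply/mem_Cnsp; exists a, b; split; last by left.
apply: contra nz_v'; rewrite -Mv -pair_eqE /= => /andP[/eqP-> /eqP->].
by rewrite mul_Mmx_colv !mul0r !addr0 colv_eq0 eqxx.
Qed.

Lemma on_axis x y : (x == 0) (+) (y == 0) ->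
  exists2 z, z != 0 & colv x y = colv z 0 \/ colv x y = colv 0 z.
Proof.
have [-> nz_y | nz_x /eqP->] := eqVneq x 0.
  by exists y; [| right].
by exists x; [| left].
Qed.

(** Serves both C_s^+(p) and G^3(p): monomial matrices preserve the union of the axes, and scalars
    with their products by [Tmx] already reach every nonzero vector there. *)
Lemma orbit_axis (G : {set 'M[F]_2}) x y :
    (forall g, g \in G -> exists a b, [/\ a != 0, b != 0 &
       g = Dmx a b \/ g = Tmx p *m Dmx a b]) ->
    (forall a, a != 0 -> Dmx a a \in G /\ Tmx p *m Dmx a a \in G) ->
    (x == 0) (+) (y == 0) ->
  #|[set g *m colv x y | g in G]| = (2 * (p - 1))%N.
Proof.
move=> G_sub sub_G xy0; rewrite -card_axes; apply: card_orbit_colv => x' y'.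
rewrite inE /=; split=> [[g /G_sub[a [b [nz_a nz_b]]]] | /on_axis[z' nz_z']].
  case=> ->; rewrite -?mulmxA mul_Dmx_colv ?mul_Tmx_colv => /colv_inj[<- <-].
    by rewrite !mulf_eq0 (negPf nz_a) (negPf nz_b).
  by rewrite !mulf_eq0 (negPf nz_a) (negPf nz_b) addbC.
have [z nz_z Dv] := on_axis xy0.
pose a := z' / z; have [|GD GT] := sub_G a.
  by rewrite mulf_neq0 ?invr_eq0.
case: Dv => -> [] ->.
- by exists (Dmx a a); rewrite // mul_Dmx_colv mulr0 divfK.
- exists (Tmx p *m Dmx a a) => //.
  by rewrite -mulmxA mul_Dmx_colv mul_Tmx_colv mulr0 divfK.
- exists (Tmx p *m Dmx a a) => //.
  by rewrite -mulmxA mul_Dmx_colv mul_Tmx_colv mulr0 divfK.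
- by exists (Dmx a a); rewrite // mul_Dmx_colv mulr0 divfK.
Qed.

Lemma orbit_Csp_axis x y : (x == 0) (+) (y == 0) ->
  #|[set g *m colv x y | g in Csp p]| = (2 * (p - 1))%N.
Proof.
apply: orbit_axis => [g /mem_Csp // | a nz_a].
by split; apply/mem_Csp; exists a, a; split=> //; [left | right].
Qed.

End Orbits.

(** * Orbits of C_s^+(p) off the axes and of the triangular groups *)

Section OrbitCounts.

Variable p : nat.
Hypothesis p_pr : prime p.
Local Notation F := 'F_p.

Lemma torsion_degrees_colv E (G : {set 'M[F]_2}) ds :
    galois_image_is E G ->
    (forall x y : F, colv x y != 0 -> #|[set g *m colv x y | g in G]| \in ds) ->
    (forall d, d \in ds -> exists x y : F,
       colv x y != 0 /\ #|[set g *m colv x y | g in G]| = d) ->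
  torsion_degrees_are E p ds.
Proof.
move=> imG ds_orbit orbit_ds.
apply: torsion_degrees_orbits imG _ _ => [v | d /orbit_ds[x [y [nz_v Dd]]]].
  by rewrite (colvE v); apply: ds_orbit.
by exists (colv x y).
Qed.

Lemma orbit_Csp_generic (x y : F) : x != 0 -> y != 0 ->
  #|[set g *m colv x y | g in Csp p]| = ((p - 1) ^ 2)%N.
Proof.
move=> nz_x nz_y; rewrite -[RHS]mulnn -{1}(card_Fp_unit p_pr).
rewrite -(card_Fp_unit p_pr) -cardsX; apply: card_orbit_colv => x' y'.
rewrite !inE /=; split=> [[g /mem_Csp[a [b [nz_a nz_b]]]] | /andP[nz_x' nz_y']].
  case=> ->; rewrite -?mulmxA mul_Dmx_colv ?mul_Tmx_colv => /colv_inj[<- <-];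
  by rewrite !mulf_neq0.
exists (Dmx (x' / x) (y' / y)); last by rewrite mul_Dmx_colv !divfK.
apply/mem_Csp; exists (x' / x), (y' / y).
by rewrite !mulf_neq0 ?invr_eq0 //; split=> //; left.
Qed.

Lemma card_line : #|setX [set~ (0 : F)] [set (0 : F)]| = (p - 1)%N.
Proof. by rewrite cardsX cards1 muln1 card_Fp_unit. Qed.

Lemma card_off_line : #|setX [set: F] [set~ (0 : F)]| = ((p - 1) * p)%N.
Proof. by rewrite cardsX cardsT card_Fp // card_Fp_unit // mulnC. Qed.

Lemma orbit_G00_axis (x : F) : x != 0 ->
  #|[set g *m colv x 0 | g in G00 p]| = (p - 1)%N.
Proof.
move=> nz_x; rewrite -card_line; apply: card_orbit_colv => x' y'.
rewrite !inE /=; split=> [[g /mem_G00[a [b [nz_a]]]] | /andP[nz_x' /eqP->]].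
  by case=> ->; rewrite mul_mx22_colv => /colv_inj[<- <-];
    rewrite !mulr0 !addr0 mul0r mulf_neq0 /=.
exists (mx22 (x' / x) 0 0 (x' / x)).
  apply/mem_G00; exists (x' / x), 0; rewrite mulf_neq0 ?invr_eq0 //.
  by split=> //; left.
by rewrite mul_mx22_colv !mulr0 mul0r !addr0 divfK.
Qed.

Lemma orbit_G00_generic (x y : F) : y != 0 ->
  #|[set g *m colv x y | g in G00 p]| = ((p - 1) * p)%N.
Proof.
move=> nz_y; rewrite -card_off_line; apply: card_orbit_colv => x' y'.
rewrite !inE /=; split=> [[g /mem_G00[a [b [nz_a]]]] | nz_y'].
  by case=> ->; rewrite mul_mx22_colv => /colv_inj[_ <-];
    rewrite !mul0r add0r mulf_neq0 ?oppr_eq0.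
(* The diagonal sends [y] to [y']; as [y] is nonzero, the upper right entry can then correct the
   first coordinate. *)
pose a := y' / y; exists (mx22 a ((x' - a * x) / y) 0 a).
  apply/mem_G00; exists a, ((x' - a * x) / y).
  by rewrite mulf_neq0 ?invr_eq0 //; split=> //; left.
by rewrite mul_mx22_colv !divfK // mul0r add0r addrC subrK.
Qed.

(** [x ^+ p./2] is 1 or -1. For p = 3 mod 4 the power of -1 is -1, so in the second case [- x]
    passes Euler's criterion. *)
Lemma square_or_opp (x : F) : odd p -> (p %% 4 = 3)%N -> x != 0 ->
  exists2 c, c != 0 & x = c ^+ 2 \/ x = - c ^+ 2.
Proof.
move=> p_odd p3 nz_x.
have sq := unity_root_exp (Fp_odd_order p_pr p_odd).
have : (x ^+ p./2) ^+ 2 == 1.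
  by rewrite -exprM -Fp_odd_order // expf_card_pred.
rewrite sqrf_eq1 => /orP[/eqP/sq[c nz_c ->] | /eqP xN1].
  by exists c; [|left].
have [|c nz_c Dc] := sq (- x).
  by rewrite exprNn xN1 m1_half_exp // mulrNN mulr1.
by exists c; [|right; rewrite -Dc opprK].
Qed.

Lemma orbit_G01_axis (x : F) : odd p -> (p %% 4 = 3)%N -> x != 0 ->
  #|[set g *m colv x 0 | g in G01 p]| = (p - 1)%N.
Proof.
move=> p_odd p3 nz_x; rewrite -card_line; apply: card_orbit_colv => x' y'.
rewrite !inE /=; split=> [[g /mem_G01[c [b [nz_c]]]] | /andP[nz_x' /eqP->]].
  by case=> ->; rewrite mul_mx22_colv => /colv_inj[<- <-];
    rewrite !mulr0 !addr0 mul0r mulf_neq0 ?oppr_eq0 ?sqrf_eq0 /=.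
(* The sign sits on the upper left entry of [G01], so this entry takes every nonzero value. *)
have [|c nz_c Dc] := @square_or_opp (x' / x) p_odd p3.
  by rewrite mulf_neq0 ?invr_eq0.
exists (mx22 (x' / x) 0 0 (c ^+ 2)).
  by apply/mem_G01; exists c, 0; split=> //; case: Dc => ->; [left|right].
by rewrite mul_mx22_colv !mulr0 mul0r !addr0 divfK.
Qed.

Lemma half_pred : odd p -> ((p - 1) %/ 2 = p./2)%N.
Proof.
move=> p_odd; by rewrite subn1 -[in LHS](card_Fp p_pr) Fp_odd_order // mulnK.
Qed.

Lemma half_mul_pred : odd p -> (((p - 1) * p) %/ 2 = p * p./2)%N.
Proof.
move=> p_odd; rewrite subn1 -[X in X.-1](card_Fp p_pr) Fp_odd_order //.
by rewrite mulnAC mulnK // mulnC.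
Qed.

Lemma orbit_G01_generic (x y : F) : odd p -> y != 0 ->
  #|[set g *m colv x y | g in G01 p]| = (((p - 1) * p) %/ 2)%N.
Proof.
move=> p_odd nz_y; have Dq := Fp_odd_order p_pr p_odd.
(* The lower right entry of [G01] is a square: the second coordinate stays in [y] times the nonzero
   squares, while the first is free. *)
have -> : (((p - 1) * p) %/ 2)%N
    = #|setX [set: F] [set y * r | r in unity_roots F p./2]|.
  rewrite cardsX cardsT card_imset; last exact: mulfI.
  by rewrite (card_unity_roots Dq) card_Fp // half_mul_pred.
apply: card_orbit_colv => x' y'; rewrite in_setX in_setT /=.
split=> [[g /mem_G01[c [b [nz_c Dg]]]] | /imsetP[r sq_r ->]].
  case: Dg => ->; rewrite mul_mx22_colv => /colv_inj[_ <-];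
  by rewrite mul0r add0r mulrC imset_f // inE square_half_exp.
move: sq_r; rewrite inE => /eqP/(unity_root_exp Dq)[c nz_c ->].
exists (mx22 (c ^+ 2) ((x' - c ^+ 2 * x) / y) 0 (c ^+ 2)).
  apply/mem_G01; exists c, ((x' - c ^+ 2 * x) / y).
  by split=> //; left.
by rewrite mul_mx22_colv divfK // mul0r add0r addrC subrK [y * _]mulrC.
Qed.

Lemma orbit_G10_axis (x : F) : odd p -> x != 0 ->
  #|[set g *m colv x 0 | g in G10 p]| = ((p - 1) %/ 2)%N.
Proof.
move=> p_odd nz_x; have Dq := Fp_odd_order p_pr p_odd.
(* In [G10] the upper left entry is a square without sign, so only half of the axis is reached. *)
have -> : ((p - 1) %/ 2)%N
    = #|setX [set x * r | r in unity_roots F p./2] [set (0 : F)]|.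
  rewrite cardsX cards1 muln1 card_imset; last exact: mulfI.
  by rewrite (card_unity_roots Dq) half_pred.
apply: card_orbit_colv => x' y'; rewrite in_setX inE.
split=> [[g /mem_G10[c [b [nz_c Dg]]]] | /andP[/imsetP[r sq_r ->] /eqP->]].
  case: Dg => ->; rewrite mul_mx22_colv => /colv_inj[<- <-];
  rewrite !mulr0 mul0r !addr0 eqxx andbT mulrC;
  by rewrite imset_f // inE square_half_exp.
move: sq_r; rewrite inE => /eqP/(unity_root_exp Dq)[c nz_c ->].
exists (mx22 (c ^+ 2) 0 0 (c ^+ 2)).
  by apply/mem_G10; exists c, 0; split=> //; left.
by rewrite mul_mx22_colv !mulr0 mul0r !addr0 mulrC.
Qed.

Lemma orbit_G10_generic (x y : F) : odd p -> (p %% 4 = 3)%N -> y != 0 ->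
  #|[set g *m colv x y | g in G10 p]| = ((p - 1) * p)%N.
Proof.
move=> p_odd p3 nz_y; rewrite -card_off_line; apply: card_orbit_colv => x' y'.
rewrite !inE /=; split=> [[g /mem_G10[c [b [nz_c]]]] | nz_y'].
  by case=> ->; rewrite mul_mx22_colv => /colv_inj[_ <-];
    rewrite !mul0r add0r mulf_neq0 ?oppr_eq0 ?sqrf_eq0.
have [|c nz_c Dc] := @square_or_opp (y' / y) p_odd p3.
  by rewrite mulf_neq0 ?invr_eq0.
exists (mx22 (c ^+ 2) ((x' - c ^+ 2 * x) / y) 0 (y' / y)).
  apply/mem_G10; exists c, ((x' - c ^+ 2 * x) / y).
  by split=> //; case: Dc => ->; [left|right].
by rewrite mul_mx22_colv !divfK // mul0r add0r addrC subrK.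
Qed.

(** * Orbits of G^3(p) through cubic classes of slopes *)

Lemma orbit_G3_axis (x y : F) : (x == 0) (+) (y == 0) ->
  #|[set g *m colv x y | g in G3 p]| = (2 * (p - 1))%N.
Proof.
apply: orbit_axis => // [g /mem_G3[a [b [nz_a nz_b Dg]]] | a nz_a].
  by exists a, (a * b ^+ 3); rewrite mulf_neq0 ?expf_neq0.
by split; apply/mem_G3; exists a, 1; rewrite expr1n mulr1 oner_neq0;
  split=> //; first [by left | by right].
Qed.

(** Nontrivial cube roots of unity are roots of X^2 + X + 1; eliminating between the two equations
    gives (a - b)(ab - 1) = 0. *)
Lemma cube_root_unity_cases (K : fieldType) (a b : K) :
  a ^+ 3 = 1 -> b ^+ 3 = 1 -> a != 1 -> b != 1 -> a = b \/ a * b = 1.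
Proof.
have quad (c : K) : c ^+ 3 = 1 -> c != 1 -> c ^+ 2 + c + 1 = 0.
  move=> c3 c1; apply: (@mulfI _ (c - 1)); first by rewrite subr_eq0.
  by transitivity (c ^+ 3 - 1); [ring | rewrite c3 subrr mulr0].
move=> a3 b3 a1 b1; have qa := quad a a3 a1; have qb := quad b b3 b1.
have /eqP: (a - b) * (a * b - 1) = 0.
  transitivity (b * (a ^+ 2 + a + 1) - a * (b ^+ 2 + b + 1)); first by ring.
  by rewrite qa qb !mulr0 subr0.
by rewrite mulf_eq0 !subr_eq0 => /orP[] /eqP; [left | right].
Qed.

Section Slopes.

Variables (K : fieldType) (a c x y x' y' : K).
Hypotheses (nz_a : a != 0) (nz_c : c != 0).
Hypotheses (nz_x : x != 0) (nz_y : y != 0) (nz_x' : x' != 0) (nz_y' : y' != 0).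

Lemma slope_scale : a * c * y / (a * x) = c * (y / x).
Proof. by field; rewrite nz_a nz_x. Qed.

Lemma slope_swap : a * x / (a * c * y) * (y / x) = c^-1.
Proof. by field; rewrite nz_a nz_c nz_x nz_y. Qed.

Lemma scale_slope : x' / x * (y' / x' / (y / x)) * y = y'.
Proof. by field; rewrite nz_x nz_x' nz_y. Qed.

Lemma swap_slope : y' / x * (y' / x' * (y / x))^-1 * y = x'.
Proof. by field; rewrite nz_x nz_x' nz_y nz_y'. Qed.

End Slopes.

Section CubicSplit.

Variable m : nat.
Hypothesis Dp : p.-1 = (m * 3)%N.

Let Dq : #|F|.-1 = (m * 3)%N. Proof. by rewrite card_Fp. Qed.

Let cube_m (b : F) : b != 0 -> (b ^+ 3) ^+ m = 1.
Proof. by move=> nz_b; rewrite -exprM mulnC -Dq expf_card_pred. Qed.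

(** The [m]-th power of the slope is its cubic residue character. Diagonal elements multiply the
    slope by a cube, and [Tmx] inverts it. Conversely, a slope ratio of trivial character is a cube,
    which supplies [b]. *)
Lemma orbit_G3E (x y x' y' : F) : x != 0 -> y != 0 ->
  (exists2 g, g \in G3 p & g *m colv x y = colv x' y') <->
  [/\ x' != 0, y' != 0 & (y' / x') ^+ m = (y / x) ^+ m
    \/ (y' / x') ^+ m * (y / x) ^+ m = 1].
Proof.
move=> nz_x nz_y; split=> [[g /mem_G3[a [b [nz_a nz_b]]]] | [nz_x' nz_y']].
  have nz_b3 := expf_neq0 3 nz_b.
  case=> ->; rewrite -?mulmxA mul_Dmx_colv ?mul_Tmx_colv => /colv_inj[<- <-].
    rewrite !mulf_neq0 //; split=> //; left.
    by rewrite slope_scale // exprMn cube_m // mul1r.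
  rewrite !mulf_neq0 //; split=> //; right.
  by rewrite -exprMn slope_swap // -exprVn cube_m ?invr_eq0.
case=> Dr.
  have [|b nz_b Db] := @unity_root_exp F m 3 ((y' / x') / (y / x)) Dq.
    by rewrite expr_div_n Dr divff // expf_neq0 // mulf_neq0 ?invr_eq0.
  exists (Dmx (x' / x) (x' / x * b ^+ 3)).
    apply/mem_G3; exists (x' / x), b; rewrite nz_b mulf_neq0 ?invr_eq0 //.
    by split=> //; left.
  by rewrite mul_Dmx_colv -Db divfK // scale_slope.
have [|b nz_b Db] := @unity_root_exp F m 3 ((y' / x') * (y / x))^-1 Dq.
  by rewrite exprVn exprMn Dr invr1.
(* The diagonal factor must produce [(y', x')], which [Tmx] then swaps; hence [y' / x] in place of
   [x' / x]. *)
exists (Tmx p *m Dmx (y' / x) (y' / x * b ^+ 3)).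
  apply/mem_G3; exists (y' / x), b; rewrite nz_b mulf_neq0 ?invr_eq0 //.
  by split=> //; right.
by rewrite -mulmxA mul_Dmx_colv mul_Tmx_colv -Db divfK // swap_slope.
Qed.

Let m_gt0 : (0 < m)%N.
Proof. by case: (m) Dp (prime_gt1 p_pr) => //; case: p => [|[]]. Qed.

Lemma orbit_G3_cube (x y : F) : x != 0 -> y != 0 -> (y / x) ^+ m = 1 ->
  #|[set g *m colv x y | g in G3 p]| = ((p - 1) * m)%N.
Proof.
move=> nz_x nz_y r1; rewrite -[in RHS](card_unity_roots Dq) -card_slopes //.
apply: card_orbit_colv => x' y'; apply: (iff_trans (orbit_G3E x' y' nz_x nz_y)).
rewrite inE /= inE r1; split=> [[nz_x' nz_y'] | /andP[nz_x' r1']].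
  by rewrite mulr1 nz_x'; case=> ->.
split=> //; last by left; apply/eqP.
have := @unity_roots_neq0 F m (y' / x') m_gt0; rewrite inE r1' => /(_ isT).
by rewrite mulf_eq0 negb_or => /andP[].
Qed.

Lemma orbit_G3_noncube (x y : F) : x != 0 -> y != 0 -> (y / x) ^+ m != 1 ->
  #|[set g *m colv x y | g in G3 p]| = ((p - 1) * (2 * m))%N.
Proof.
move=> nz_x nz_y r1.
(* The two nontrivial cubic classes are inverse to each other, so the orbit contains all noncube
   slopes: 3m - m of them. *)
have cardR : #|[set~ 0] :\: unity_roots F m| = (2 * m)%N.
  rewrite cardsD card_Fp_unit // (setIidPr _); last first.
    by apply/subsetP=> r /(unity_roots_neq0 m_gt0); rewrite !inE.
  rewrite (card_unity_roots Dq) subn1 Dp.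
  by rewrite -[X in (_ - X)%N]muln1 -mulnBr mulnC.
rewrite -cardR -card_slopes //.
apply: card_orbit_colv => x' y'; apply: (iff_trans (orbit_G3E x' y' nz_x nz_y)).
have m3 (r : F) : r != 0 -> (r ^+ m) ^+ 3 = 1.
  by move=> nz_r; rewrite -exprM -Dq expf_card_pred.
have nz_r : y / x != 0 by rewrite mulf_neq0 ?invr_eq0.
rewrite !inE /=; split=> [[nz_x' nz_y' Dr] | /and3P[nz_x' r1' nz_r']].
  rewrite nz_x' mulf_neq0 ?invr_eq0 // andbT /=.
  case: Dr => [-> // | Dr]; apply: contra r1 => /eqP r1'.
  by rewrite r1' mul1r in Dr; rewrite Dr.
split=> //; first by move: nz_r'; rewrite mulf_eq0 negb_or => /andP[].
exact: cube_root_unity_cases (m3 _ _) (m3 _ _) _ _.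
Qed.

End CubicSplit.

End OrbitCounts.

(** * Nonsplit orbits through the field with p^2 elements *)

Lemma Fp2_exists p : prime p ->
  exists2 L : finFieldType, #|L| = (p ^ 2)%N & inhabited {rmorphism 'F_p -> L}.
Proof.
move=> p_pr; have [L pcharL cardL] := @pPrimePowerField p 2 p_pr isT.
pose f : {rmorphism 'F_p -> pPrimeCharType pcharL} :=
  in_alg (pPrimeCharType pcharL).
by exists L; last exact: (inhabits f).
Qed.

Section NonsplitOrbits.

Variable p : nat.
Hypotheses (p_pr : prime p) (p_odd : odd p).
Local Notation F := 'F_p.

Lemma eps_half_exp : eps p ^+ p./2 = -1.
Proof.
have nz_eps : eps p != 0.
  by have := eps_nonsquare p_pr 0 p_odd; rewrite expr0n eq_sym.
have : (eps p ^+ p./2) ^+ 2 == 1.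
  by rewrite -exprM -Fp_odd_order // expf_card_pred.
rewrite sqrf_eq1 => /orP[/eqP eps1 | /eqP //].
have [c _ Dc] := unity_root_exp (Fp_odd_order p_pr p_odd) eps1.
by have := eps_nonsquare p_pr c p_odd; rewrite Dc eqxx.
Qed.

Variables (L : finFieldType) (iota : {rmorphism F -> L}).
Hypothesis cardL : #|L| = (p ^ 2)%N.

(** In [L] the Euler power of [eps] is (-1)^(p + 1) = 1, so [eps] acquires a root [w]; then w^p =
    (w^2)^(p./2) w = -w. *)
Lemma sqrt_eps_exists : exists2 w : L, w ^+ 2 = iota (eps p) & w ^+ p = - w.
Proof.
have Dq : #|L|.-1 = ((p./2 * p.+1) * 2)%N.
  rewrite cardL mulnAC -(Fp_odd_order p_pr p_odd) card_Fp //.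
  by rewrite -!subn1 -[p.+1]addn1 -subn_sqr.
have [|w nz_w Dw] := @unity_root_exp L _ 2 (iota (eps p)) Dq.
  rewrite -rmorphXn /= exprM eps_half_exp -signr_odd /= p_odd expr0.
  by rewrite rmorph1.
exists w => //; have -> : p = (p./2 * 2).+1.
  by rewrite -{1}(odd_double_half p) p_odd muln2.
rewrite exprSr [(_ * 2)%N]mulnC exprM -Dw -rmorphXn eps_half_exp.
by rewrite rmorphN1 mulN1r.
Qed.

Variable w : L.
Hypotheses (w2 : w ^+ 2 = iota (eps p)) (wp : w ^+ p = - w).

(** Coordinates of [L] in the basis 1, [w]: [phi_mul] turns [Mmx] into multiplication and [phi_frob]
    turns [Jmx] into Frobenius. *)
Let phi (u : F * F) : L := iota u.1 + iota u.2 * w.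

Let phi_frob x y : phi (x, y) ^+ p = phi (x, - y).
Proof.
have pcharL : p \in [pchar L] := rmorph_pchar iota (pchar_Fp p_pr).
have iotaX (a : F) : iota a ^+ p = iota a.
  by rewrite -rmorphXn -[X in _ ^+ X](card_Fp p_pr) expf_card.
rewrite /phi exprDn_pchar ?pnatE //= exprMn !iotaX wp.
by rewrite rmorphN mulrN mulNr.
Qed.

Let phi_mul a b x y :
  phi (a * x + b * eps p * y, b * x + a * y) = phi (a, b) * phi (x, y).
Proof.
rewrite /phi /= !rmorphD !rmorphM -w2; ring.
Qed.

Let phi_eq0 x y : (phi (x, y) == 0) = (colv x y == 0).
Proof.
rewrite colv_eq0; apply/eqP/andP=> [|[/eqP-> /eqP->]]; last first.
  by rewrite /phi rmorph0 mul0r addr0.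
rewrite /phi /=; have [-> | nz_y /eqP] := eqVneq y 0.
  by rewrite rmorph0 mul0r addr0 => /eqP; rewrite fmorph_eq0.
rewrite addr_eq0 => /eqP Dx; have /eqP[] := eps_nonsquare p_pr (x / y) p_odd.
apply: (fmorph_inj iota); rewrite rmorphXn fmorph_div Dx -w2.
by rewrite -mulNr mulrAC exprMn mulNr divff ?fmorph_eq0 // sqrrN expr1n mul1r.
Qed.

Let phi_bij : bijective phi.
Proof.
apply: inj_card_bij; last by rewrite cardL card_prod !card_Fp // mulnn.
move=> [x y] [x' y'] /eqP; rewrite -subr_eq0.
have -> : phi (x, y) - phi (x', y') = phi (x - x', y - y').
  by rewrite /phi /= !rmorphB; ring.
by rewrite phi_eq0 colv_eq0 !subr_eq0 => /andP[/eqP-> /eqP->].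
Qed.

Lemma orbit_G0E (x y x' y' : F) :
  (exists2 g, g \in G0 p & g *m colv x y = colv x' y') <->
  exists2 b : L, b != 0 & phi (x', y') = b ^+ 3 * phi (x, y)
                       \/ phi (x', y') = (b ^+ 3 * phi (x, y)) ^+ p.
Proof.
(* The image coordinates stay existential, since only their value under [phi] matters. *)
have cube a b s t : exists s' t', Mmx a b ^+ 3 *m colv s t = colv s' t'
    /\ phi (s', t') = phi (a, b) ^+ 3 * phi (s, t).
  rewrite !exprS expr0 mulr1; do 2!eexists; split.
    by rewrite -!mulmxE -!mulmxA !mul_Mmx_colv.
  by rewrite !phi_mul -!mulrA expr0 mul1r.
split=> [[g /mem_G0[a [b [nz_ab Dg]]] Dv] | [c nz_c Dv']].
  exists (phi (a, b)); first by rewrite phi_eq0 colv_eq0 -pair_eqE in nz_ab *.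
  have [s [t [Dst Phi]]] := cube a b x y.
  move: Dv; case: Dg => ->; rewrite -?[Jmx p *m _ *m _]mulmxA Dst ?mul_Jmx_colv.
    by case/colv_inj=> <- <-; left.
  by case/colv_inj=> <- <-; right; rewrite -Phi phi_frob.
(* Surjectivity of [phi] turns the multiplier [c] into matrix entries [a] and [b]. *)
have [psi phiK psiK] := phi_bij.
move: (psiK c) nz_c Dv'; case: (psi c) => a b <-; rewrite phi_eq0 => nz_ab Dv'.
have [s [t [Dst Phi]]] := cube a b x y; rewrite -Phi in Dv'.
have phi_inj s1 t1 s2 t2 :
    phi (s1, t1) = phi (s2, t2) -> colv s1 t1 = colv s2 t2.
  move/(bij_inj phi_bij)/eqP; rewrite -pair_eqE.
  by case/andP=> /eqP /= -> /eqP /= ->.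
have nz_pair : (a, b) != (0, 0) by rewrite -pair_eqE /= -colv_eq0.
case: Dv' => [/phi_inj | ]; last rewrite phi_frob => /phi_inj.
  move->; exists (Mmx a b ^+ 3) => //.
  by apply/mem_G0; exists a, b; split; [|left].
move->; exists (Jmx p *m Mmx a b ^+ 3).
  by apply/mem_G0; exists a, b; split; [|right].
by rewrite -mulmxA Dst mul_Jmx_colv.
Qed.

Variable m : nat.
Hypotheses (Dp : (p ^ 2).-1 = (m * 3)%N) (p_mod3 : (p %% 3 = 2)%N).

Let Dq : #|L|.-1 = (m * 3)%N. Proof. by rewrite cardL. Qed.

Let m_gt0 : (0 < m)%N.
Proof.
case: (m) Dp => // Dp0; have := prime_gt1 p_pr; rewrite -(ltn_sqr 1) => p2.
by move: p2; rewrite -[(p ^ 2)%N]prednK ?Dp0 // expn_gt0 prime_gt0.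
Qed.

Let cube_m (b : L) : b != 0 -> (b ^+ 3) ^+ m = 1.
Proof. by move=> nz_b; rewrite -exprM mulnC -Dq expf_card_pred. Qed.

Let card_phi (S : {set L}) : #|phi @^-1: S| = #|S|.
Proof. by apply: on_card_preimset; apply: onW_bij phi_bij. Qed.

Lemma orbit_G0_cube (x y : F) : phi (x, y) ^+ m = 1 ->
  #|[set g *m colv x y | g in G0 p]| = m.
Proof.
move=> a1; rewrite -[RHS](card_unity_roots Dq) -card_phi.
apply: card_orbit_colv => x' y'; apply: (iff_trans (orbit_G0E x y x' y')).
rewrite !inE; split=> [[b nz_b [] ->] | /eqP a1'].
- by rewrite exprMn cube_m // mul1r a1.
- by rewrite exprAC exprMn cube_m // mul1r a1 expr1n.
have nz_a : phi (x, y) != 0.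
  by apply: (unity_roots_neq0 m_gt0); rewrite inE a1.
have [|b nz_b Db] := @unity_root_exp L m 3 (phi (x', y') / phi (x, y)) Dq.
  by rewrite expr_div_n a1 a1' divr1.
by exists b => //; left; rewrite -Db divfK.
Qed.

Lemma orbit_G0_noncube (x y : F) :
    phi (x, y) != 0 -> phi (x, y) ^+ m != 1 ->
  #|[set g *m colv x y | g in G0 p]| = (2 * m)%N.
Proof.
move=> nz_a a1.
have cardS : #|[set~ 0] :\: unity_roots L m| = (2 * m)%N.
  rewrite cardsD (setIidPr _); last first.
    by apply/subsetP=> r /(unity_roots_neq0 m_gt0); rewrite !inE.
  rewrite (card_unity_roots Dq) cardsC1 Dq.
  by rewrite -[X in (_ - X)%N]muln1 -mulnBr mulnC.
have m3 (r : L) : r != 0 -> (r ^+ m) ^+ 3 = 1.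
  by move=> nz_r; rewrite -exprM -Dq expf_card_pred.
(* The exponent is m(p + 1), and 3 divides p + 1: Frobenius inverts the cubic character. *)
have frob (r : L) : r != 0 -> (r ^+ m) * (r ^+ p) ^+ m = 1.
  move=> nz_r; rewrite exprAC -exprS.
  have -> : p.+1 = (3 * (p %/ 3).+1)%N.
    by rewrite [RHS]mulnS [in LHS](divn_eq p 3) p_mod3 mulnC addnC.
  by rewrite exprM m3 // expr1n.
rewrite -cardS -card_phi.
apply: card_orbit_colv => x' y'; apply: (iff_trans (orbit_G0E x y x' y')).
rewrite !inE; split=> [[b nz_b Da'] | /andP[a1' nz_a']].
  have nz_ba : b ^+ 3 * phi (x, y) != 0 by rewrite mulf_neq0 ?expf_neq0.
  have Dba : (b ^+ 3 * phi (x, y)) ^+ m = phi (x, y) ^+ m.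
    by rewrite exprMn cube_m // mul1r.
  case: Da' => ->; first by rewrite Dba a1.
  rewrite expf_neq0 // andbT; apply: contra a1 => /eqP fr1.
  by have := frob _ nz_ba; rewrite fr1 mulr1 Dba => ->.
have nz_fr := expf_neq0 p nz_a'.
have [Da|Da] := cube_root_unity_cases (m3 _ nz_a') (m3 _ nz_a) a1' a1.
  have [|b nz_b Db] := @unity_root_exp L m 3 (phi (x', y') / phi (x, y)) Dq.
    by rewrite expr_div_n Da divff // expf_neq0.
  by exists b => //; left; rewrite -Db divfK.
have [|b nz_b Db] := @unity_root_exp L m 3 (phi (x', y') ^+ p / phi (x, y)) Dq.
  rewrite expr_div_n.
  have -> : (phi (x', y') ^+ p) ^+ m = phi (x, y) ^+ m.
    by apply: (mulfI (expf_neq0 m nz_a')); rewrite frob // Da.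
  by rewrite divff // expf_neq0.
(* Frobenius applied twice is the identity on [L], which has p^2 elements. *)
by exists b => //; right; rewrite -Db divfK // -exprM mulnn -cardL expf_card.
Qed.

Lemma torsion_degrees_G0_quadratic E : galois_image_is E (G0 p) ->
  torsion_degrees_are E p [:: m; 2 * m]%N.
Proof.
move=> imG; apply: torsion_degrees_colv imG _ _ => [x y nz_v | d].
  rewrite !inE; have [a1 | a1] := eqVneq (phi (x, y) ^+ m) 1.
    by rewrite orbit_G0_cube ?eqxx.
  by rewrite orbit_G0_noncube ?eqxx ?orbT ?phi_eq0.
rewrite !inE => /orP[] /eqP->.
  exists 1, 0; rewrite colv_eq0 oner_eq0; split=> //; apply: orbit_G0_cube.
  by rewrite /phi rmorph1 rmorph0 mul0r addr0 expr1n.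
(* A noncube of [L], pulled back by [phi], represents the large orbit; [(1, 0)] corresponds to 1 and
   represents the cubes. *)
have [a nz_a a1] := exists_nonroot (isT : 1 < 3)%N Dq.
have [psi phiK psiK] := phi_bij.
move: (psiK a) nz_a a1; case: (psi a) => x y <- nz_a a1.
by exists x, y; rewrite -phi_eq0 nz_a; split=> //; apply: orbit_G0_noncube.
Qed.

End NonsplitOrbits.

(** * Degree sets for each group *)

Section Degrees.

Variables (p : nat) (E : elliptic_curve rat).
Hypothesis p_pr : prime p.
Local Notation F := 'F_p.

Lemma torsion_degrees_transitive (G : {set 'M[F]_2}) :
    galois_image_is E G ->
    (forall x y : F, colv x y != 0 ->
       #|[set g *m colv x y | g in G]| = (p ^ 2 - 1)%N) ->
  torsion_degrees_are E p [:: p ^ 2 - 1]%N.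
Proof.
move=> imG orbitG; apply: torsion_degrees_colv imG _ _ => [x y nz_v | d].
  by rewrite orbitG ?mem_head.
rewrite inE => /eqP->; by exists 1, 0; rewrite orbitG ?colv_eq0 ?oner_eq0.
Qed.

Lemma torsion_degrees_triangular (G : {set 'M[F]_2}) d1 d2 :
    galois_image_is E G ->
    (forall x : F, x != 0 -> #|[set g *m colv x 0 | g in G]| = d1) ->
    (forall x y : F, y != 0 -> #|[set g *m colv x y | g in G]| = d2) ->
  torsion_degrees_are E p [:: d1; d2].
Proof.
move=> imG orbit1 orbit2; apply: torsion_degrees_colv imG _ _ => [x y | d].
  rewrite colv_eq0 !inE; have [-> | nz_y _] := eqVneq y 0.
    by rewrite andbT => /orbit1->; rewrite eqxx.
  by rewrite orbit2 // eqxx orbT.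
rewrite !inE => /orP[] /eqP->.
  by exists 1, 0; rewrite colv_eq0 orbit1 ?oner_eq0.
by exists 0, 1; rewrite colv_eq0 orbit2 ?oner_eq0 ?andbF.
Qed.

Lemma colv_axis_or (x y : F) : colv x y != 0 ->
  (x == 0) (+) (y == 0) \/ x != 0 /\ y != 0.
Proof. by rewrite colv_eq0; case: eqP; case: eqP => //; [left|left|right]. Qed.

Lemma torsion_degrees_Csp : galois_image_is E (Csp p) ->
  torsion_degrees_are E p [:: 2 * (p - 1); (p - 1) ^ 2]%N.
Proof.
move=> imG; apply: torsion_degrees_colv imG _ _ => [x y | d].
  case/colv_axis_or=> [ax | [nz_x nz_y]]; rewrite !inE.
    by rewrite orbit_Csp_axis ?eqxx.
  by rewrite orbit_Csp_generic ?eqxx ?orbT.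
rewrite !inE => /orP[] /eqP->.
  by exists 1, 0; rewrite colv_eq0 orbit_Csp_axis ?eqxx ?oner_eq0.
by exists 1, 1; rewrite colv_eq0 orbit_Csp_generic ?oner_eq0.
Qed.

Lemma torsion_degrees_G3 : (p %% 3 = 1)%N -> galois_image_is E (G3 p) ->
  torsion_degrees_are E p
    [:: 2 * (p - 1); (p - 1) ^ 2 %/ 3; (2 * (p - 1) ^ 2) %/ 3]%N.
Proof.
move=> p_mod3; pose m := (p %/ 3)%N.
have Dp : p.-1 = (m * 3)%N by rewrite [in LHS](divn_eq p 3) p_mod3 addn1.
have Dq : #|F|.-1 = (m * 3)%N by rewrite card_Fp.
have -> : ((p - 1) ^ 2 %/ 3 = (p - 1) * m)%N.
  by rewrite -mulnn subn1 [X in (_ * X %/ _)%N]Dp mulnA mulnK.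
have -> : ((2 * (p - 1) ^ 2) %/ 3 = (p - 1) * (2 * m))%N.
  by rewrite -mulnn mulnCA subn1 [X in (_ * (_ * X) %/ _)%N]Dp !mulnA mulnK.
move=> imG; apply: torsion_degrees_colv imG _ _ => [x y | d].
  case/colv_axis_or=> [ax | [nz_x nz_y]]; rewrite !inE.
    by rewrite orbit_G3_axis ?eqxx.
  have [r1 | r1] := eqVneq ((y / x) ^+ m) 1.
    by rewrite (orbit_G3_cube p_pr Dp) ?eqxx ?orbT.
  by rewrite (orbit_G3_noncube p_pr Dp) ?eqxx ?orbT.
rewrite !inE => /or3P[] /eqP->.
- by exists 1, 0; rewrite colv_eq0 orbit_G3_axis ?eqxx ?oner_eq0.
- exists 1, 1; rewrite colv_eq0 (orbit_G3_cube p_pr Dp) ?oner_eq0 //.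
  by rewrite divr1 expr1n.
(* The vector [(1, r)] has slope [r], so a noncube [r] realizes the largest class, as [(1, 1)] does
   for cubes. *)
have [r nz_r r1] := exists_nonroot (isT : 1 < 3)%N Dq.
exists 1, r; rewrite colv_eq0 (orbit_G3_noncube p_pr Dp) ?oner_eq0 //.
by rewrite divr1.
Qed.

Lemma torsion_degrees_G0 : odd p -> (p %% 3 = 2)%N ->
    galois_image_is E (G0 p) ->
  torsion_degrees_are E p [:: (p ^ 2 - 1) %/ 3; (2 * (p ^ 2 - 1)) %/ 3]%N.
Proof.
move=> p_odd p_mod3; have [L cardL [iota]] := Fp2_exists p_pr.
have [w w2 wp] := sqrt_eps_exists p_pr p_odd iota cardL.
have : (3 %| p ^ 2 - 1)%N.
  by rewrite -(eqn_mod_dvd 3) ?expn_gt0 ?prime_gt0 // -modnXm p_mod3.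
case/dvdnP=> m Dp; rewrite Dp mulnA !mulnK //; rewrite subn1 in Dp.
exact: (torsion_degrees_G0_quadratic p_pr p_odd cardL w2 wp Dp p_mod3).
Qed.

End Degrees.

Close Scope ring_scope.

Theorem theorem5p6 (p : nat) (E : elliptic_curve rat) :
  prime p ->
  (galois_image_is E (GL2 p) -> torsion_degrees_are E p [:: p ^ 2 - 1]) /\
  (odd p -> galois_image_is E (Cnsp p) ->
     torsion_degrees_are E p [:: p ^ 2 - 1]) /\
  (odd p -> galois_image_is E (Csp p) ->
     torsion_degrees_are E p [:: 2 * (p - 1); (p - 1) ^ 2]) /\
  (p \in [:: 3; 7; 11; 19; 43; 67; 163] -> galois_image_is E (G00 p) ->
     torsion_degrees_are E p [:: p - 1; (p - 1) * p]) /\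
  (p \in [:: 3; 7; 11; 19; 43; 67; 163] -> galois_image_is E (G01 p) ->
     torsion_degrees_are E p [:: p - 1; ((p - 1) * p) %/ 2]) /\
  (p \in [:: 3; 7; 11; 19; 43; 67; 163] -> galois_image_is E (G10 p) ->
     torsion_degrees_are E p [:: (p - 1) %/ 2; (p - 1) * p]) /\
  (p %% 3 = 1 -> galois_image_is E (G3 p) ->
     torsion_degrees_are E p
       [:: 2 * (p - 1); (p - 1) ^ 2 %/ 3; (2 * (p - 1) ^ 2) %/ 3]) /\
  (odd p -> p %% 3 = 2 -> galois_image_is E (G0 p) ->
     torsion_degrees_are E p [:: (p ^ 2 - 1) %/ 3; (2 * (p ^ 2 - 1)) %/ 3]).
Proof.
move=> p_pr.
(* Being 3 modulo 4 makes -1 a nonsquare, so signed squares exhaust the units in [G01] and [G10]. *)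
have p_list : p \in [:: 3; 7; 11; 19; 43; 67; 163] -> odd p /\ p %% 4 = 3.
  by rewrite !inE; do 6?[case/orP]; move/eqP->.
do 7?[apply: conj].
- move=> imG; apply: torsion_degrees_transitive imG _ => x y.
  exact: orbit_GL2.
- move=> p_odd imG; apply: torsion_degrees_transitive imG _ => x y.
  exact: orbit_Cnsp.
- by move=> _; apply: torsion_degrees_Csp.
- move=> _ imG; apply: torsion_degrees_triangular imG _ _ => [x|x y].
    exact: orbit_G00_axis.
  exact: orbit_G00_generic.
- move=> /p_list[p_odd p3] imG.
  apply: torsion_degrees_triangular imG _ _ => [x|x y].
    exact: orbit_G01_axis.
  exact: orbit_G01_generic.
- move=> /p_list[p_odd p3] imG.
  apply: torsion_degrees_triangular imG _ _ => [x|x y].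
    exact: orbit_G10_axis.
  exact: orbit_G10_generic.
- exact: torsion_degrees_G3.
- exact: torsion_degrees_G0.
Qed.
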